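(* Let $Q$ be a $\mathbb{Z}_n$-minimal quiver of Type B, a $\mathbb Z_n$-stable subquiver of $K_{m,m'}$ with $m,m'\ge 1$ both dividing $n$. Any $T(n)$-action on the path algebra $\Bbbk Q$ (extending the $\mathbb Z_n$-action on $Q$) is given by $$x\cdot b^i_j=\gamma_-\zeta^jb^i_j-\gamma_+\mu_{i,j}\zeta^{i+1}b^{i+1}_{j+1}+\lambda_{i,j}b^i_{j+1},$$ where $\gamma_+,\gamma_-\in\Bbbk$ are the scalars with $x\cdot e_{i_+}=\gamma_+\zeta^i(e_{i_+}-\zeta e_{(i+1)_+})$ and $x\cdot e_{j_-}=\gamma_-\zeta^j(e_{j_-}-\zeta e_{(j+1)_-})$, the $\mu_{i,j}\in\Bbbk^\times$ are the scalars with $g\cdot b^i_j=\mu_{i,j}b^{i+1}_{j+1}$, and $\lambda_{i,j}\in\Bbbk$, these scalars satisfying - $\prod_{\ell=0}^{n-1}\mu_{i+\ell,j+\ell}=1$; - $\lambda_{i,j}=0$ if the arrow $b^i_{j+1}$ does not exist in $Q$; - $\lambda_{i+1,j+1}\mu_{i,j}=\zeta\lambda_{i,j}\mu_{i,j+1}$; - $(\gamma_+)^n=(\gamma_-)^n+\prod_{\ell=0}^{n-1}\lambda_{i,j+\ell}$. The superindices of arrows are taken modulo $m$ and the subindices of arrows are taken modulo $m'$ (and likewise for the first and second indices of the scalars).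
   Context: Let $n\ge2$ be an integer and $\Bbbk$ a field containing a primitive $n$-th root of unity $\zeta$. The Taft algebra $T(n)$ is the $n^2$-dimensional Hopf algebra generated by $g,x$ with relations $g^n=1$, $x^n=0$, $xg=\zeta gx$, and $\Delta(g)=g\otimes g$, $\Delta(x)=1\otimes x+x\otimes g$, $\varepsilon(g)=1$, $\varepsilon(x)=0$. The group generated by $g$ is identified with $\mathbb Z_n$. A Hopf algebra $H$ acts on an algebra $A$ if $A$ is a left $H$-module with $h\cdot(pq)=\sum(h_1\cdot p)(h_2\cdot q)$ and $h\cdot1_A=\varepsilon(h)1_A$. All actions on path algebras are assumed to preserve the path length filtration. $K_{m,m'}$ is the quiver with vertices $1_+,\dots,m_+,1_-,\dots,m'_-$ and one arrow $b^i_j$ from $i_+$ to $j_-$ for all $i,j$. The generator $g$ of $\mathbb Z_n$ acts on vertices by $i_+\mapsto(i+1)_+$ modulo $m$ and $j_-\mapsto(j+1)_-$ modulo $m'$, so $b^i_j\mapsto b^{i+1}_{j+1}$ on arrows. A $\mathbb Z_n$-minimal quiver of Type B is a $\mathbb Z_n$-stable subquiver of $K_{m,m'}$. A $T(n)$-action on $\Bbbk Q$ extends the $\mathbb Z_n$-action on $Q$ if $g\cdot e_{i_+}=e_{(i+1)_+}$, $g\cdot e_{j_-}=e_{(j+1)_-}$, and $g\cdot b^i_j$ is a nonzero scalar multiple $\mu_{i,j}b^{i+1}_{j+1}$ for all arrows $b^i_j$ of $Q$. Products in $\Bbbk Q$ compose paths left to right; trivial paths are denoted $e_v$. The formulas and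 conditions are for pairs $(i,j)$ with $b^i_j$ an arrow of $Q$; a term with factor $\lambda_{i,j}=0$ is read as zero. The scalars $\gamma_\pm$ exist for every $T(n)$-action, with $\gamma_+=0$ if $m<n$ and $\gamma_-=0$ if $m'<n$. *)

(* Defs.v *)
From HB Require Import structures.
From mathcomp Require Import all_boot all_order all_algebra.
From mathcomp Require Import finmap zify.
From mathcomp Require Export monalg.

Set Implicit Arguments.
Unset Strict Implicit.
Unset Printing Implicit Defensive.

Import GRing.Theory.
Local Open Scope ring_scope.

(* Locked, as unification otherwise unfolds it down to the supports. *)
HB.lock Definition lext (K : fieldType) (B : choiceType) (V : lmodType K)
    (f : B -> V) (u : {malg K[B]}) : V :=
  \sum_(b <- msupp u) u@_b *: f b.

Section LinearExtension.
Variable K : fieldType.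

Definition bext (B C : choiceType) (V : lmodType K) (f : B -> C -> V)
    (u : {malg K[B]}) (v : {malg K[C]}) : V :=
  lext (fun b => lext (f b) v) u.

Section Linear.
Variables (B : choiceType) (V : lmodType K).

Lemma lextE (f : B -> V) (u : {malg K[B]}) :
  lext f u = \sum_(b <- msupp u) u@_b *: f b.
Proof. by rewrite lext.unlock. Qed.

Lemma lextEw (f : B -> V) (u : {malg K[B]}) (d : {fset B}) :
  (msupp u `<=` d)%fset -> lext f u = \sum_(b <- d) u@_b *: f b.
Proof.
move=> le; rewrite lextE (big_fset_incl _ le) // => b _ nb.
by rewrite mcoeff_outdom // scale0r.
Qed.

Lemma lext_is_linear (f : B -> V) : linear (lext f).
Proof.
move=> a u v; set d := (msupp u `|` msupp v)%fset.
have le : (msupp (a *: u + v) `<=` d)%fset.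
  apply: (fsubset_trans (msuppD_le _ _)); rewrite fsetUSS //.
  exact: msuppZ_le.
rewrite (lextEw _ le) (@lextEw f u d) ?fsubsetUl // (@lextEw f v d) ?fsubsetUr //.
rewrite scaler_sumr -big_split /=; apply: eq_bigr => b _.
by rewrite mcoeffD mcoeffZ scalerDl scalerA.
Qed.

HB.instance Definition _ (f : B -> V) :=
  GRing.isLinear.Build K {malg K[B]} V _ (lext f) (lext_is_linear f).

Lemma lextU (f : B -> V) b : lext f << b >> = f b.
Proof. by rewrite lextE msuppU oner_eq0 big_seq_fset1 mcoeffUU scale1r. Qed.

Lemma lext_sum (I : Type) (r : seq I) (P : pred I) (f : B -> V)
    (F : I -> {malg K[B]}) :
  lext f (\sum_(i <- r | P i) F i) = \sum_(i <- r | P i) lext f (F i).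
Proof. exact: linear_sum. Qed.

End Linear.

Lemma malg_lind (B : choiceType) (P : {malg K[B]} -> Prop) :
    P 0 -> (forall a u v, P u -> P v -> P (a *: u + v)) ->
    (forall b, P << b >>) ->
  forall u, P u.
Proof.
move=> P0 PD PU u; rewrite (monalgE u).
elim/big_rec: _ => // b v _ Pv.
have -> : << u@_b *g b >> = u@_b *: << b >> :> {malg K[B]}.
  by apply/malgP => k; rewrite mcoeffZ !mcoeffU mulrnAr mulr1.
exact: PD.
Qed.

Section Bilinear.
Variables (B C : choiceType) (V : lmodType K).

Lemma bextUl (f : B -> C -> V) b v : bext f << b >> v = lext (f b) v.
Proof. exact: lextU. Qed.

Lemma bextU (f : B -> C -> V) b c : bext f << b >> << c >> = f b c.
Proof. by rewrite bextUl lextU. Qed.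

Lemma bext0l (f : B -> C -> V) v : bext f 0 v = 0.
Proof. exact: linear0. Qed.

Lemma bextPl (f : B -> C -> V) a u u' v :
  bext f (a *: u + u') v = a *: bext f u v + bext f u' v.
Proof. exact: linearP. Qed.

Lemma bext0r (f : B -> C -> V) u : bext f u 0 = 0.
Proof. by rewrite /bext [LHS]lextE big1 // => b _; rewrite linear0 scaler0. Qed.

Lemma bextPr (f : B -> C -> V) a u v v' :
  bext f u (a *: v + v') = a *: bext f u v + bext f u v'.
Proof.
rewrite /bext [LHS]lextE [X in _ = a *: X + _]lextE [X in _ = _ + X]lextE scaler_sumr -big_split /=.
by apply: eq_bigr => b _; rewrite linearP scalerDr !scalerA mulrC.
Qed.

Lemma bextZl (f : B -> C -> V) a u v : bext f (a *: u) v = a *: bext f u v.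
Proof. by rewrite -[a *: u]addr0 bextPl bext0l addr0. Qed.

Lemma bextZr (f : B -> C -> V) a u v : bext f u (a *: v) = a *: bext f u v.
Proof. by rewrite -[a *: v]addr0 bextPr bext0r addr0. Qed.

Lemma bextDl (f : B -> C -> V) u u' v :
  bext f (u + u') v = bext f u v + bext f u' v.
Proof. by rewrite -[u]scale1r bextPl !scale1r. Qed.

Lemma bextDr (f : B -> C -> V) u v v' :
  bext f u (v + v') = bext f u v + bext f u v'.
Proof. by rewrite -[v]scale1r bextPr !scale1r. Qed.

End Bilinear.
End LinearExtension.

(* Associative unital algebras given by a basis and structure constants.  The
   zero algebra is allowed (it is the path algebra of the empty quiver), so
   that the ring structure is only a pzRingType, and lalgType, which demands
   1 != 0, is not available. *)
Record scalg (K : fieldType) := SCAlg {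
  sc_basis : choiceType;
  sc_mul : sc_basis -> sc_basis -> {malg K[sc_basis]};
  sc_one : {malg K[sc_basis]};
  sc_mulA : forall a b c,
    bext sc_mul (sc_mul a b) << c >> = bext sc_mul << a >> (sc_mul b c);
  sc_mul1l : forall a, bext sc_mul sc_one << a >> = << a >>;
  sc_mul1r : forall a, bext sc_mul << a >> sc_one = << a >>
}.

Definition sc_carrier (K : fieldType) (S : scalg K) : Type :=
  {malg K[sc_basis S]}.
Coercion sc_carrier : scalg >-> Sortclass.

Section SCRing.
Variables (K : fieldType) (S : scalg K).

HB.instance Definition _ := GRing.Lmodule.copy (sc_carrier S) {malg K[sc_basis S]}.

Let mul (u v : S) : S := bext (@sc_mul K S) u v.

Fact sc_mulrA : associative mul.
Proof.
move=> u v w; elim/malg_lind: u => [|a u u' IHu IHu'|a].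
- by rewrite /mul !bext0l.
- by rewrite /mul !bextPl [X in a *: X]IHu [X in _ + X]IHu'.
elim/malg_lind: v => [|c v v' IHv IHv'|b].
- by rewrite /mul bext0l !bext0r bext0l.
- rewrite /mul bextPl !bextPr bextPl.
  by rewrite [X in c *: X]IHv [X in _ + X]IHv'.
elim/malg_lind: w => [|c w w' IHw IHw'|c].
- by rewrite /mul !bext0r.
- by rewrite /mul !bextPr [X in c *: X]IHw [X in _ + X]IHw'.
by rewrite /mul (bextU _ b c) (bextU _ a b) sc_mulA.
Qed.

Fact sc_mul1x : left_id (sc_one S) mul.
Proof.
elim/malg_lind => [|a u v IHu IHv|b]; first exact: bext0r.
  by rewrite /mul bextPr [X in a *: X]IHu [X in _ + X]IHv.
exact: sc_mul1l.
Qed.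

Fact sc_mulx1 : right_id (sc_one S) mul.
Proof.
elim/malg_lind => [|a u v IHu IHv|b]; first exact: bext0l.
  by rewrite /mul bextPl [X in a *: X]IHu [X in _ + X]IHv.
exact: sc_mul1r.
Qed.

Fact sc_mulDl : left_distributive mul +%R.
Proof. by move=> u v w; exact: bextDl. Qed.

Fact sc_mulDr : right_distributive mul +%R.
Proof. by move=> u v w; exact: bextDr. Qed.

HB.instance Definition _ := GRing.Zmodule_isPzRing.Build (sc_carrier S)
  sc_mulrA sc_mul1x sc_mulx1 sc_mulDl sc_mulDr.

Definition sc_elt (b : sc_basis S) : S := << b >>.

Lemma sc_mulE (u v : S) : u * v = bext (@sc_mul K S) u v.
Proof. by []. Qed.

Lemma sc_oneE : 1 = sc_one S :> S.
Proof. by []. Qed.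

Lemma sc_eltM b c : sc_elt b * sc_elt c = sc_mul b c.
Proof. exact: bextU. Qed.

Lemma sc_scaleAl a (u v : S) : a *: (u * v) = (a *: u) * v.
Proof. by rewrite !sc_mulE bextZl. Qed.

Lemma sc_scaleAr a (u v : S) : a *: (u * v) = u * (a *: v).
Proof. by rewrite !sc_mulE bextZr. Qed.

End SCRing.

Section Tensor.
Variables (K : fieldType).

Definition ptens (B C : choiceType) :
    {malg K[B]} -> {malg K[C]} -> {malg K[(B * C)%type]} :=
  bext (fun b c => << (b, c) >>).

Section PureTensor.
Variables B C : choiceType.
Implicit Types (u : {malg K[B]}) (v : {malg K[C]}).

Lemma ptens0l v : ptens (0 : {malg K[B]}) v = 0.
Proof. exact: bext0l. Qed.

Lemma ptens0r u : ptens u (0 : {malg K[C]}) = 0.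
Proof. exact: bext0r. Qed.

Lemma ptensPl a u u' v : ptens (a *: u + u') v = a *: ptens u v + ptens u' v.
Proof. exact: bextPl. Qed.

Lemma ptensPr a u v v' : ptens u (a *: v + v') = a *: ptens u v + ptens u v'.
Proof. exact: bextPr. Qed.

Lemma ptensU (b : B) (c : C) : ptens << b >> << c >> = << (b, c) >>.
Proof. exact: bextU. Qed.

End PureTensor.

Variables (S T : scalg K).
Let B := (sc_basis S * sc_basis T)%type.

Definition tens_mul (a b : B) : {malg K[B]} :=
  ptens (sc_mul a.1 b.1) (sc_mul a.2 b.2).

Lemma tens_mulE u u' v v' :
  bext tens_mul (ptens u v) (ptens u' v') =
  ptens (bext (@sc_mul K S) u u') (bext (@sc_mul K T) v v').
Proof.
elim/malg_lind: u => [|a x y IHx IHy|b].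
- by rewrite !ptens0l !bext0l ptens0l.
- by rewrite ptensPl !bextPl ptensPl IHx IHy.
elim/malg_lind: u' => [|a x y IHx IHy|b'].
- by rewrite !ptens0l !bext0r ptens0l.
- by rewrite !ptensPl !bextPr ptensPl IHx IHy.
elim/malg_lind: v => [|a x y IHx IHy|c].
- by rewrite ptens0r !bext0l ptens0r.
- by rewrite ptensPr !bextPl ptensPr IHx IHy.
elim/malg_lind: v' => [|a x y IHx IHy|c'].
- by rewrite ptens0r !bext0r ptens0r.
- by rewrite ptensPr !bextPr ptensPr IHx IHy.
by rewrite !ptensU !bextU.
Qed.

Fact tens_mulA a b c :
  bext tens_mul (tens_mul a b) << c >> = bext tens_mul << a >> (tens_mul b c).
Proof.
have E (d : B) : << d >> = ptens << d.1 >> << d.2 >>.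
  by rewrite ptensU; case: d.
by rewrite (E a) (E c) !tens_mulE !sc_mulA.
Qed.

Fact tens_mul1l a :
  bext tens_mul (ptens (sc_one S) (sc_one T)) << a >> = << a >>.
Proof.
have E (d : B) : << d >> = ptens << d.1 >> << d.2 >>.
  by rewrite ptensU; case: d.
by rewrite (E a) tens_mulE !sc_mul1l.
Qed.

Fact tens_mul1r a :
  bext tens_mul << a >> (ptens (sc_one S) (sc_one T)) = << a >>.
Proof.
have E (d : B) : << d >> = ptens << d.1 >> << d.2 >>.
  by rewrite ptensU; case: d.
by rewrite (E a) tens_mulE !sc_mul1r.
Qed.

Definition tens : scalg K := SCAlg tens_mulA tens_mul1l tens_mul1r.

Definition tensor (u : S) (v : T) : tens := ptens u v.

End Tensor.

(* In the fifth clause, if Delta h = sum_s c_s (s.1 (x) s.2) in the basis of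
   H (x) H, the right-hand side is sum_s c_s (s.1 . p)(s.2 . q). *)
Definition module_algebra (K : fieldType) (H : scalg K)
    (Delta : H -> tens H H) (eps : H -> K) (A : scalg K)
    (act : H -> A -> A) : Prop :=
  [/\ forall h, linear (act h),
      forall p, linear (act^~ p),
      forall p, act 1 p = p
    & forall h h' p, act (h * h') p = act h (act h' p)] /\
  (forall h p q, act h (p * q) =
     lext (fun s => act (sc_elt s.1) p * act (sc_elt s.2) q) (Delta h)) /\
  (forall h, act h 1 = eps h *: (1 : A)).

Section Taft.
Variables (K : fieldType) (n : nat) (zeta : K).
Let B := ('I_n * 'I_n)%type.

(* The basis element (a, b) stands for g^a x^b.  For arbitrary naturals a, b,
   tmon a b is g^a x^b: the exponent of g is reduced modulo n, and the sum is
   empty if n <= b. *)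
Definition tmon (a b : nat) : {malg K[B]} :=
  \sum_(p : B | (p.1 == a %% n :> nat)%N && (p.2 == b :> nat)) << p >>.

(* x g = zeta g x gives (g^a x^b)(g^c x^d) = zeta^(b c) g^(a+c) x^(b+d). *)
Definition taft_mul (p q : B) : {malg K[B]} :=
  zeta ^+ (p.2 * q.1) *: tmon (p.1 + q.1) (p.2 + q.2).

Hypothesis prim : n.-primitive_root zeta.

Let n_gt0 : (0 < n)%N := prim_order_gt0 prim.

Lemma tmonE a b (hb : (b < n)%N) :
  tmon a b = << (Ordinal (ltn_pmod a n_gt0), Ordinal hb) >>.
Proof.
by rewrite /tmon (big_pred1 (Ordinal (ltn_pmod a n_gt0), Ordinal hb)).
Qed.

Lemma tmon_ge a b : (n <= b)%N -> tmon a b = 0.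
Proof.
move=> hb; rewrite /tmon big_pred0 // => -[c d] /=.
by apply/negP => /andP[_ /eqP E]; move: (ltn_ord d); rewrite E ltnNge hb.
Qed.

Lemma tmon_mod a b : tmon (a %% n) b = tmon a b.
Proof. by rewrite /tmon modn_mod. Qed.

Lemma tmon_basis (p : B) : << p >> = tmon p.1 p.2.
Proof.
rewrite (tmonE _ (ltn_ord p.2)); congr << _ >>.
case: p => a b /=; congr pair; apply: val_inj => //=.
by rewrite modn_small.
Qed.

Lemma taft_mulE a b c d :
  bext taft_mul (tmon a b) (tmon c d) =
  zeta ^+ (b * c) *: tmon (a + c) (b + d).
Proof.
case: (ltnP b n) => hb; last first.
  by rewrite tmon_ge // bext0l tmon_ge ?scaler0 // (leq_trans hb) ?leq_addr.
case: (ltnP d n) => hd; last first.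
  by rewrite (tmon_ge c hd) bext0r tmon_ge ?scaler0 // (leq_trans hd) ?leq_addl.
rewrite (tmonE a hb) (tmonE c hd) bextU /taft_mul /=.
have -> : zeta ^+ (b * (c %% n)) = zeta ^+ (b * c).
  by rewrite !(mulnC b) !exprM -(prim_expr_mod prim c).
by rewrite -(tmon_mod (_ + _)) modnDm tmon_mod.
Qed.

Fact taft_mulA a b c :
  bext taft_mul (taft_mul a b) << c >> = bext taft_mul << a >> (taft_mul b c).
Proof.
rewrite /taft_mul bextZl bextZr !tmon_basis !taft_mulE !scalerA -!exprD.
set e := (X in zeta ^+ X *: _ = _); set e' := (X in _ = zeta ^+ X *: _).
have -> : e = e' by rewrite /e /e' mulnDl mulnDr; lia.
by rewrite !addnA.
Qed.

Fact taft_mul1l a : bext taft_mul (tmon 0 0) << a >> = << a >>.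
Proof. by rewrite !tmon_basis taft_mulE mul0n expr0 scale1r. Qed.

Fact taft_mul1r a : bext taft_mul << a >> (tmon 0 0) = << a >>.
Proof. by rewrite !tmon_basis taft_mulE muln0 expr0 scale1r !addn0. Qed.

Definition taft : scalg K := SCAlg taft_mulA taft_mul1l taft_mul1r.

Definition taft_g : taft := tmon 1 0.
Definition taft_x : taft := tmon 0 1.

(* The multiplicative map with Delta(g) = g (x) g and
   Delta(x) = 1 (x) x + x (x) g, on the basis g^a x^b. *)
Definition taft_Delta (h : taft) : tens taft taft :=
  lext (fun p : B =>
    tensor taft_g taft_g ^+ p.1 *
    (tensor 1 taft_x + tensor taft_x taft_g) ^+ p.2 : tens taft taft) h.

(* The multiplicative map with eps(g) = 1 and eps(x) = 0. *)
Definition taft_eps (h : taft) : K :=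
  lext (fun p : B => 1 ^+ p.1 * 0 ^+ p.2 : K^o) h.

Lemma taft_gX a : taft_g ^+ a = tmon a 0.
Proof.
elim: a => [|a IH] //.
by rewrite exprS IH sc_mulE taft_mulE mul0n expr0 scale1r.
Qed.

Lemma taft_xX b : taft_x ^+ b = tmon 0 b.
Proof.
elim: b => [|b IH] //.
by rewrite exprS IH sc_mulE taft_mulE mul1n expr0 scale1r.
Qed.

Lemma taft_basisE (p : B) : sc_elt (S := taft) p = taft_g ^+ p.1 * taft_x ^+ p.2.
Proof.
rewrite taft_gX taft_xX sc_mulE taft_mulE mul0n expr0 scale1r addn0.
exact: tmon_basis.
Qed.

Lemma taft_gn : taft_g ^+ n = 1.
Proof. by rewrite taft_gX -tmon_mod modnn. Qed.

Lemma taft_xn : taft_x ^+ n = 0.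
Proof. by rewrite taft_xX tmon_ge. Qed.

Lemma taft_xg : taft_x * taft_g = zeta *: (taft_g * taft_x).
Proof. by rewrite !sc_mulE !taft_mulE mul1n mul0n expr0 expr1 scale1r. Qed.

Lemma taft_Delta_tmon a b : (b < n)%N ->
  taft_Delta (tmon a b) = tensor taft_g taft_g ^+ (a %% n) *
                          (tensor 1 taft_x + tensor taft_x taft_g) ^+ b.
Proof. by move=> hb; rewrite /taft_Delta (tmonE a hb) lextU. Qed.

Lemma taft_eps_tmon a b : (b < n)%N ->
  taft_eps (tmon a b) = 1 ^+ (a %% n) * 0 ^+ b.
Proof. by move=> hb; rewrite /taft_eps (tmonE a hb) lextU. Qed.

Hypothesis n_gt1 : (1 < n)%N.

Lemma taft_Delta_g : taft_Delta taft_g = tensor taft_g taft_g.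
Proof. by rewrite [LHS]taft_Delta_tmon // modn_small // expr1 mulr1. Qed.

Lemma taft_Delta_x :
  taft_Delta taft_x = tensor 1 taft_x + tensor taft_x taft_g.
Proof. by rewrite [LHS]taft_Delta_tmon // mod0n expr0 expr1 mul1r. Qed.

Lemma taft_eps_g : taft_eps taft_g = 1.
Proof. by rewrite [LHS]taft_eps_tmon // expr1n mulr1. Qed.

Lemma taft_eps_x : taft_eps taft_x = 0.
Proof. by rewrite [LHS]taft_eps_tmon // expr1 mulr0. Qed.

End Taft.

Arguments taft_g {K n zeta} prim.
Arguments taft_x {K n zeta} prim.

Record quiver := Quiver {
  vert : finType;
  arrow : finType;
  src : arrow -> vert;
  tgt : arrow -> vert
}.

Section Paths.
Variable Q : quiver.

Fixpoint is_walk (v : vert Q) (s : seq (arrow Q)) : bool :=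
  if s is a :: s' then (src a == v) && is_walk (tgt a) s' else true.

(* A path is its starting vertex with its sequence of arrows, read from left
   to right; the trivial path e_v is (v, [::]). *)
Definition qpath : Type := {p : vert Q * seq (arrow Q) | is_walk p.1 p.2}.
HB.instance Definition _ := Choice.on qpath.
HB.instance Definition _ := SubType.on qpath.

Definition pstart (p : qpath) : vert Q := (val p).1.
Definition parrows (p : qpath) : seq (arrow Q) := (val p).2.
Definition pend (p : qpath) : vert Q := last (pstart p) (map (@tgt Q) (parrows p)).
Definition plen (p : qpath) : nat := size (parrows p).

Definition ptriv (v : vert Q) : qpath :=
  exist (fun p => is_walk p.1 p.2) (v, [::]) isT.

Fact parrow_subproof (a : arrow Q) : is_walk (src a) [:: a].
Proof. by rewrite /= eqxx. Qed.
Definition parrow (a : arrow Q) : qpath :=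
  exist (fun p => is_walk p.1 p.2) (src a, [:: a]) (parrow_subproof a).

(* Only meaningful if pend p = pstart q, see val_pcat. *)
Definition pcat (p q : qpath) : qpath :=
  insubd p (pstart p, parrows p ++ parrows q).

Lemma is_walk_cat v s s' :
  is_walk v (s ++ s') = is_walk v s && is_walk (last v (map (@tgt Q) s)) s'.
Proof. by elim: s v => //= a s IH v; rewrite IH andbA. Qed.

Lemma val_pcat p q : pend p = pstart q ->
  val (pcat p q) = (pstart p, parrows p ++ parrows q).
Proof.
move=> E; rewrite insubdK // unfold_in /= is_walk_cat.
by rewrite (valP p) -[last _ _]/(pend p) E (valP q).
Qed.

Lemma pstart_cat p q : pend p = pstart q -> pstart (pcat p q) = pstart p.
Proof. by move=> E; rewrite /pstart val_pcat. Qed.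

Lemma pend_cat p q : pend p = pstart q -> pend (pcat p q) = pend q.
Proof.
move=> E; rewrite {1}/pend /parrows pstart_cat // val_pcat //= map_cat last_cat.
by rewrite -[last _ _]/(last (pend p) _) E.
Qed.

Variable K : fieldType.

Definition path_mul (p q : qpath) : {malg K[qpath]} :=
  if pend p == pstart q then << pcat p q >> else 0.

Definition path_one : {malg K[qpath]} := \sum_(v : vert Q) << ptriv v >>.

Lemma path_mul_cat p q : pend p = pstart q -> path_mul p q = << pcat p q >>.
Proof. by rewrite /path_mul => ->; rewrite eqxx. Qed.

Lemma path_mul_0 p q : pend p != pstart q -> path_mul p q = 0.
Proof. by rewrite /path_mul => /negPf ->. Qed.

Fact path_mulA a b c :
  bext path_mul (path_mul a b) << c >> = bext path_mul << a >> (path_mul b c).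
Proof.
have [ab|nab] := eqVneq (pend a) (pstart b);
  have [bc|nbc] := eqVneq (pend b) (pstart c).
- rewrite (path_mul_cat ab) (path_mul_cat bc).
  rewrite (bextU _ (pcat a b) c) (bextU _ a (pcat b c)).
  have abc : pend (pcat a b) = pstart c by rewrite pend_cat.
  have abc' : pend a = pstart (pcat b c) by rewrite pstart_cat.
  rewrite (path_mul_cat abc) (path_mul_cat abc').
  suff -> : pcat (pcat a b) c = pcat a (pcat b c) by [].
  apply: val_inj.
  rewrite !val_pcat ?pend_cat ?pstart_cat // /parrows !val_pcat //=.
  by rewrite catA.
- rewrite (path_mul_cat ab) (path_mul_0 nbc) bext0r (bextU _ (pcat a b) c).
  by rewrite path_mul_0 // pend_cat.
- rewrite (path_mul_0 nab) (path_mul_cat bc) bext0l (bextU _ a (pcat b c)).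
  by rewrite path_mul_0 // pstart_cat.
- by rewrite (path_mul_0 nab) (path_mul_0 nbc) bext0l bext0r.
Qed.

Fact path_mul1l a : bext path_mul path_one << a >> = << a >>.
Proof.
have E : pend (ptriv (pstart a)) = pstart a by [].
rewrite /bext /path_one lext_sum (bigD1_seq (pstart a)) ?index_enum_uniq ?mem_index_enum //=.
rewrite big1 => [|v nv]; last by rewrite !lextU path_mul_0.
rewrite !lextU (path_mul_cat E) addr0.
suff -> : pcat (ptriv (pstart a)) a = a by [].
by apply: val_inj; rewrite val_pcat //= [RHS]surjective_pairing.
Qed.

Fact path_mul1r a : bext path_mul << a >> path_one = << a >>.
Proof.
have E : pend a = pstart (ptriv (pend a)) by [].
rewrite bextUl /path_one lext_sum (bigD1_seq (pend a)) ?index_enum_uniq ?mem_index_enum //=.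
rewrite big1 => [|v nv]; last by rewrite !lextU path_mul_0 // eq_sym.
rewrite !lextU (path_mul_cat E) addr0.
suff -> : pcat a (ptriv (pend a)) = a by [].
by apply: val_inj; rewrite val_pcat //= cats0 [RHS]surjective_pairing.
Qed.

Definition path_alg : scalg K := SCAlg path_mulA path_mul1l path_mul1r.

Definition path_filt (d : nat) (u : path_alg) : Prop :=
  forall p, p \in msupp (u : {malg K[qpath]}) -> (plen p <= d)%N.

End Paths.

Record subquiver (Q : quiver) := Subquiver {
  svert : {set vert Q};
  sarrow : {set arrow Q};
  ssrc : forall a, a \in sarrow -> src a \in svert;
  stgt : forall a, a \in sarrow -> tgt a \in svert
}.

Definition quiver_of (Q : quiver) (R : subquiver Q) : quiver :=
  @Quiver {v : vert Q | v \in svert R} {a : arrow Q | a \in sarrow R}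
    (fun a => exist (fun v => v \in svert R) (src (val a)) (ssrc (valP a)))
    (fun a => exist (fun v => v \in svert R) (tgt (val a)) (stgt (valP a))).

Section SubPathAlgebra.
Variables (K : fieldType) (Q : quiver) (R : subquiver Q).

(* The trivial path at v, resp. the arrow a, as an element of the path algebra
   of R; it is 0 if v, resp. a, does not belong to R. *)
Definition pe (v : vert Q) : path_alg (quiver_of R) K :=
  if insub v is Some w then << ptriv (Q := quiver_of R) w >> else 0.

Definition pb (a : arrow Q) : path_alg (quiver_of R) K :=
  if insub a is Some b then << parrow (Q := quiver_of R) b >> else 0.

End SubPathAlgebra.

(* 'I_m stands for the integers modulo m and ordS for i |-> i + 1 modulo m, so
   that the vertex m_+ is represented by the ordinal 0. *)
Definition Kquiver (m m' : nat) : quiver :=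
  @Quiver ('I_m + 'I_m')%type ('I_m * 'I_m')%type
    (fun a => inl a.1) (fun a => inr a.2).

Definition g_vert m m' (v : vert (Kquiver m m')) : vert (Kquiver m m') :=
  match v with inl i => inl (ordS i) | inr j => inr (ordS j) end.

Definition g_arrow m m' (a : arrow (Kquiver m m')) : arrow (Kquiver m m') :=
  (ordS a.1, ordS a.2).

Definition Zn_stable m m' (R : subquiver (Kquiver m m')) : Prop :=
  (forall v, v \in svert R -> g_vert v \in svert R) /\
  (forall a, a \in sarrow R -> g_arrow a \in sarrow R).

Section TypeB.
Variables (K : fieldType) (m m' : nat) (R : subquiver (Kquiver m m')).

Definition vplus (i : 'I_m) : vert (Kquiver m m') := inl i.
Definition vminus (j : 'I_m') : vert (Kquiver m m') := inr j.
Definition barr (i : 'I_m) (j : 'I_m') : arrow (Kquiver m m') := (i, j).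

Definition ep (i : 'I_m) : path_alg (quiver_of R) K := pe K R (vplus i).
Definition em (j : 'I_m') : path_alg (quiver_of R) K := pe K R (vminus j).
Definition b_ (i : 'I_m) (j : 'I_m') : path_alg (quiver_of R) K :=
  pb K R (barr i j).

Variables (n : nat) (zeta : K) (prim : n.-primitive_root zeta).
Variable act : taft prim -> path_alg (quiver_of R) K -> path_alg (quiver_of R) K.

Definition taft_action : Prop :=
  module_algebra (@taft_Delta K n zeta prim) (@taft_eps K n zeta prim) act /\
  (forall h d u, path_filt d u -> path_filt d (act h u)).

Definition extends_Zn_action : Prop :=
  [/\ forall i, vplus i \in svert R -> act (taft_g prim) (ep i) = ep (ordS i),
      forall j, vminus j \in svert R -> act (taft_g prim) (em j) = em (ordS j)
    & forall i j, barr i j \in sarrow R ->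
        exists2 mu : K, mu != 0 &
          act (taft_g prim) (b_ i j) = mu *: b_ (ordS i) (ordS j)].

End TypeB.

(* Main.v *)
Require Import Defs.
From HB Require Import structures.
From mathcomp Require Import all_boot all_order all_algebra.
From mathcomp Require Import finmap ring.

(** The generator g acts by an algebra automorphism sigma, and since
Delta(x) = 1 (x) x + x (x) g, the generator x acts by a skew derivation:
delta (p q) = p delta(q) + delta(p) sigma(q).  The relations of the Taft
algebra become sigma^n = 1, delta^n = 0 and delta sigma = zeta sigma delta.

Vertices ([delta_cyclic_idempotents]).  Preservation of the filtration puts
delta(e_v) in the span of the trivial paths.  Applying delta to e_i e_i = e_i
confines delta(e_i) to the span of e_i and e_{i+1}; applying it to
e_{i+1} e_i = 0 ties the second coefficient of delta(e_i) to the first one of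
delta(e_{i+1}); and delta sigma = zeta sigma delta makes the first coefficient
grow by a factor zeta at each step.  Going once round a cycle of length m < n
then forces it to vanish, as zeta^m is not 1.

Arrows ([delta_arrow], [delta_grid]).  Expanding delta(b) from b = e_{i+} b
and from b = b e_{j-} determines delta(b) up to its component in
e_{i+} A e_{(j+1)-}, which is spanned by the arrow from i+ to (j+1)-, if there
is one; lambda is the remaining coefficient.  The relation between lambda and
mu is delta sigma = zeta sigma delta read off on an arrow ([lambda_sigma]), and
the product of the mu is 1 because sigma^n = 1.

The n-th power ([iter_arrow_action]).  On the span of the arrows, delta is a
sum D + L + G of three monomial operators, which send b^i_j to multiples of
b^i_j, b^i_{j+1} and b^{i+1}_{j+1}.  They satisfy D L = zeta L D,
D G = zeta G D and L G = zeta G L (the last one is the relation between lambda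
and mu), so the q-binomial theorem at a primitive n-th root of unity
([qbinomial_root]), used twice, gives delta^n = D^n + L^n + G^n.  The three
powers multiply b^i_j by gamma_-^n, by the product of the lambda and by
- gamma_+^n, and delta^n = 0. *)

Set Implicit Arguments.
Unset Strict Implicit.
Unset Printing Implicit Defensive.

Import GRing.Theory.
Local Open Scope ring_scope.

(** * Cyclic shifts of ordinals *)

Section CyclicOrdinals.
Variable m : nat.
Implicit Type i : 'I_m.

Lemma val_iter_ordS k i : iter k (@ordS m) i = ((i + k) %% m)%N :> nat.
Proof.
elim: k => [|k IH] /=; first by rewrite addn0 modn_small.
by rewrite IH -addn1 modnDml addn1 addnS.
Qed.

Lemma iter_ordS_id n i : (m %| n)%N -> iter n (@ordS m) i = i.
Proof.
case/dvdnP=> q ->; apply: val_inj.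
by rewrite /= val_iter_ordS addnC modnMDl modn_small.
Qed.

Lemma ordS_fixed i : ordS i = i -> m = 1%N.
Proof.
move/(congr1 val) => /=; case: i => i /= lt.
have [lt'|] := ltnP i.+1 m.
  by rewrite modn_small // => /eqP; rewrite gtn_eqF.
move=> le; have -> : m = i.+1 by apply/eqP; rewrite eqn_leq le.
by rewrite modnn => <-.
Qed.

End CyclicOrdinals.

(** A map of finite order that preserves a set also preserves its complement:
its inverse is one of its powers. *)
Lemma stable_preimset (T : finType) (S : {set T}) (f : T -> T) n t :
  (forall u, u \in S -> f u \in S) -> (0 < n)%N -> iter n f t = t ->
  f t \in S -> t \in S.
Proof.
move=> fS; case: n => // n _ E ft; rewrite -E iterSr.
by elim: n {E} => //= n IH; apply: fS.
Qed.

(** * The q-binomial theorem *)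

Section GaussBinomial.
Variables (K : fieldType) (q : K).

Fixpoint qbin (n k : nat) : K :=
  match n, k with
  | _, 0%N => 1
  | 0%N, _.+1 => 0
  | n'.+1, k'.+1 => qbin n' k' + q ^+ k'.+1 * qbin n' k'.+1
  end.

Arguments qbin : simpl never.

Lemma qbin0 n : qbin n 0 = 1. Proof. by case: n. Qed.

Lemma qbinS n k : qbin n.+1 k.+1 = qbin n k + q ^+ k.+1 * qbin n k.+1.
Proof. by []. Qed.

Lemma qbin_gt n k : (n < k)%N -> qbin n k = 0.
Proof.
elim: n k => [|n IH] [|k] // lt.
by rewrite qbinS !IH ?mulr0 ?addr0 // ltnW.
Qed.

(** The quotient-free form of [n+1 choose k+1] = [n+1]/[k+1] [n choose k], which
makes sense also where the q-integer [k+1] vanishes. *)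
Lemma qbin_absorb n k :
  (1 - q ^+ k.+1) * qbin n.+1 k.+1 = (1 - q ^+ n.+1) * qbin n k.
Proof.
elim: n k => [|n IH] k.
  by rewrite qbinS; case: k => [|k];
    rewrite ?qbin0 !qbin_gt // !mulr0 addr0 ?mulr0.
have B : (q ^+ k - q ^+ n.+1) * qbin n.+1 k
          = q ^+ k * (1 - q ^+ n.+1) * qbin n k.
  case: k => [|k]; first by rewrite !qbin0 !expr0 !mulr1 mul1r.
  (* Substituting the induction hypothesis in Pascal's rule gives the absorption
     of the lower index. *)
  have P := qbinS n k.
  have I := IH k; move: P I; set s := qbin n.+1 k.+1.
  move: (qbin n k) (qbin n k.+1) (q ^+ k.+1) (q ^+ n.+1) => a b x y P I.
  have -> : (x - y) * s = (1 - y) * s - (1 - x) * s by ring.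
  by rewrite I P; ring.
have I := IH k; rewrite qbinS mulrDr mulrCA I.
have -> : q ^+ k.+1 * ((1 - q ^+ n.+1) * qbin n k)
          = q * (q ^+ k * (1 - q ^+ n.+1) * qbin n k) by rewrite exprS; ring.
by rewrite -B !exprS; ring.
Qed.

(** Here 1 - q^n = 0 while 1 - q^k is invertible, so absorption kills the
interior coefficients. *)
Lemma qbin_root n k : n.-primitive_root q -> (0 < k < n)%N -> qbin n k = 0.
Proof.
case: n k => [|n] [|k] // prim; rewrite ltnS => lt.
have := qbin_absorb n k; rewrite (prim_expr_order prim) subrr mul0r.
move/eqP; rewrite mulf_eq0 subr_eq0 eq_sym => /orP[|/eqP //].
by rewrite -(prim_order_dvd prim) gtnNdvd.
Qed.

Variables (V : lmodType K) (f h : {linear V -> V}).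
Hypothesis fh : forall v, f (h v) = q *: h (f v).

Lemma qcomm_iter k v : f (iter k h v) = q ^+ k *: iter k h (f v).
Proof.
elim: k => [|k IH] /=; first by rewrite scale1r.
by rewrite fh IH linearZ scalerA -exprS.
Qed.

Lemma qbinomial_iter n v :
  iter n (fun w => f w + h w) v =
  \sum_(k < n.+1) qbin n k *: iter k h (iter (n - k) f v).
Proof.
elim: n => [|n IH]; first by rewrite big_ord1 /= qbin0 scale1r.
rewrite iterS IH !linear_sum /= [RHS]big_ord_recl /= qbin0 scale1r.
under [X in _ = _ + X]eq_bigr => k _ do
  rewrite /bump leq0n add1n subSS qbinS scalerDl addrC.
rewrite big_split /= addrA; congr (_ + _); last first.
  by apply: eq_bigr => k _; rewrite linearZ.
rewrite big_ord_recl /= qbin0 scale1r subn0 /=; congr (_ + _).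
rewrite [RHS]big_ord_recr /= qbin_gt // mulr0 scale0r addr0.
apply: eq_bigr => k _; rewrite /bump leq0n add1n linearZ /=.
by rewrite -iterS qcomm_iter scalerA mulrC -iterS subnSK.
Qed.

(** For q-commuting operators at a primitive n-th root of unity, taking the n-th
power is additive, as the Frobenius map is in characteristic p. *)
Lemma qbinomial_root n v : n.-primitive_root q ->
  iter n (fun w => f w + h w) v = iter n f v + iter n h v.
Proof.
move=> prim; rewrite qbinomial_iter; have n0 := prim_order_gt0 prim.
case: n n0 prim => // n _ prim.
rewrite big_ord_recl /= qbin0 scale1r; congr (_ + _).
rewrite big_ord_recr /= big1 => [|k _]; last first.
  by rewrite /bump add1n qbin_root ?scale0r //= ltnS.
rewrite add0r /bump add1n subnn.
have -> : qbin n.+1 n.+1 = 1; last by rewrite scale1r.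
elim: n.+1 => [|k IH]; first by rewrite qbin0.
by rewrite qbinS IH qbin_gt // mulr0 addr0.
Qed.

End GaussBinomial.

Lemma iter_monomial (K : fieldType) (V : lmodType K) (f : {linear V -> V})
    (I : Type) (v : I -> V) (c : I -> K) (s : I -> I) :
  (forall t, f (v t) = c t *: v (s t)) -> forall k t,
  iter k f (v t) = (\prod_(l < k) c (iter l s t)) *: v (iter k s t).
Proof.
move=> fv; elim=> [|k IH] t /=; first by rewrite big_ord0 scale1r.
by rewrite IH linearZ /= fv scalerA big_ord_recr.
Qed.

(** * Scalars that vanish on short cycles *)

Section CyclicScalars.
Variables (K : fieldType) (n : nat) (zeta : K).
Hypothesis prim : n.-primitive_root zeta.
Variables (m : nat) (c : K).
Hypotheses (hmn : (m %| n)%N) (hc : (m < n)%N -> c = 0).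

(** The scalar c stands for gamma_+ or gamma_-.  Exponents of zeta may be reduced
modulo m next to c: either m = n, or c = 0. *)
Lemma scal_root_mod k : c * zeta ^+ (k %% m)%N = c * zeta ^+ k.
Proof.
have := dvdn_leq (prim_order_gt0 prim) hmn.
rewrite leq_eqVlt => /orP[/eqP ->|/hc ->].
  by rewrite prim_expr_mod.
by rewrite !mul0r.
Qed.

(** The sign is that of the constant term of 'X^n - 1, which is the product of
the - zeta^l. *)
Lemma prod_scal_root (i : 'I_m) :
  \prod_(l < n) (- (c * zeta ^+ (iter l (@ordS m) i).+1)) = - c ^+ n.
Proof.
transitivity (\prod_(l < n) ((c * zeta ^+ i.+1) * (0 - zeta ^+ l))).
  apply: eq_bigr => l _; rewrite sub0r mulrN -mulrA -exprD addSn !exprS.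
  by rewrite val_iter_ordS !(mulrCA c) scal_root_mod.
rewrite big_split prodr_const card_ord exprMn exprAC (prim_expr_order prim).
rewrite expr1n mulr1 /=.
suff -> : \prod_(l < n) (0 - zeta ^+ l) = -1 by rewrite mulrN1.
have := congr1 (horner^~ 0) (factor_Xn_sub_1 prim).
rewrite big_mkord horner_prod !hornerE expr0n.
rewrite (gtn_eqF (prim_order_gt0 prim)) sub0r => <-.
by apply: eq_bigr => l _; rewrite !hornerE.
Qed.

End CyclicScalars.

(** * Skew derivations, idempotents and arrows *)

Section SkewDerivation.
Variables (K : fieldType) (A : scalg K) (zeta : K).
Variables sigma delta : {linear A -> A}.
Hypothesis sigmaM : forall p q, sigma (p * q) = sigma p * sigma q.
Hypothesis deltaM : forall p q, delta (p * q) = p * delta q + delta p * sigma q.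
Hypothesis delta_sigma : forall p, delta (sigma p) = zeta *: sigma (delta p).

Section CyclicIdempotents.
Variable n : nat.
Hypotheses (n_gt1 : (1 < n)%N) (prim : n.-primitive_root zeta).
Variables (m : nat) (e : 'I_m -> A) (C : 'I_m -> 'I_m -> K).
Hypothesis m_gt0 : (0 < m)%N.
Hypothesis ee : forall i k, e i * e k = if i == k then e i else 0.
Hypothesis sigma_e : forall i, sigma (e i) = e (ordS i).
Hypothesis e_delta : forall i k, e k * delta (e i) = C i k *: e k.
Hypothesis delta_e : forall i k, delta (e i) * e k = C i k *: e k.

Let i0 : 'I_m := Ordinal m_gt0.

Lemma iter_ordS0 (i : 'I_m) : i = iter i (@ordS m) i0.
Proof. by apply: val_inj; rewrite /= val_iter_ordS add0n modn_small. Qed.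

(** The e_i are the trivial paths at the vertices of one orbit; they all vanish
if that orbit lies outside the quiver. *)
Lemma cyclic_eq0 i : e i = 0 -> forall k, e k = 0.
Proof.
have sI k j : e j = 0 -> e (iter k (@ordS m) j) = 0.
  by move=> ej; elim: k => //= k IH; rewrite -sigma_e IH linear0.
move=> ei k; rewrite (iter_ordS0 k); apply: (sI).
have -> : i0 = iter (m - i) (@ordS m) i; last exact: sI.
by apply: val_inj; rewrite /= val_iter_ordS subnKC ?modnn // ltnW.
Qed.

(** The Leibniz rule for e_i e_k = 0 or e_i leaves one free scalar per vertex, and
the commutation with sigma makes these scalars a geometric progression with
ratio zeta.  The role of [C i k] is that of the coordinate of delta(e_i) at
the k-th vertex. *)
Lemma delta_cyclic_idempotents : exists c : K,
  ((m < n)%N -> c = 0) /\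
  forall i, delta (e i) = (c * zeta ^+ i) *: (e i - zeta *: e (ordS i)).
Proof.
have [e0|ne0] := eqVneq (e i0) 0.
  exists 0; split=> // i; have z := cyclic_eq0 e0.
  by rewrite !z linear0 mul0r scale0r.
have ne i : e i != 0 by apply/eqP => /cyclic_eq0 z; rewrite z eqxx in ne0.
have scalI i a b : a *: e i = b *: e i -> a = b.
  move/eqP; rewrite -subr_eq0 -scalerBl scaler_eq0 subr_eq0 (negPf (ne i)) orbF.
  by move/eqP.
(* From e_i = e_i e_i. *)
have deltaE i : delta (e i) = C i i *: e i + C i (ordS i) *: e (ordS i).
  have {1}-> : e i = e i * e i by rewrite ee eqxx.
  by rewrite deltaM sigma_e e_delta delta_e.
(* From delta sigma = zeta sigma delta, multiplied by e_{i+1}. *)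
have CSE i : C (ordS i) (ordS i) = zeta * C i i.
  apply: (scalI (ordS i)); rewrite -e_delta -sigma_e delta_sigma.
  by rewrite -sc_scaleAr -sigmaM e_delta linearZ scalerA sigma_e.
have CiterE k i :
    C (iter k (@ordS m) i) (iter k (@ordS m) i) = zeta ^+ k * C i i.
  by elim: k => [|k IH] /=; rewrite ?mul1r // CSE IH mulrA -exprS.
have Ci i : C i i = C i0 i0 * zeta ^+ i.
  by rewrite {1 2}(iter_ordS0 i) CiterE mulrC.
(* Back at the starting point after m steps. *)
have c0 : (m < n)%N -> C i0 i0 = 0.
  move=> lt; have := CiterE m i0; rewrite iter_ordS_id // => /eqP.
  rewrite -{1}[C i0 i0]mul1r -subr_eq0 -mulrBl mulf_eq0 subr_eq0 eq_sym.
  by rewrite -(prim_order_dvd prim) gtnNdvd //= => /eqP.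
exists (C i0 i0); split=> // i; rewrite -Ci scalerBr scalerA mulrC -CSE deltaE.
have [Si|nSi] := eqVneq (ordS i) i.
  by rewrite !Si Ci c0 ?(ordS_fixed Si) // !mul0r !scale0r subr0 addr0.
(* From e_{i+1} e_i = 0. *)
congr (_ + _); rewrite -scaleNr; congr (_ *: _).
apply: (scalI (ordS i)); apply/eqP; rewrite scaleNr -addr_eq0.
have := deltaM (e (ordS i)) (e i); rewrite ee (negPf nSi) linear0 sigma_e.
by rewrite e_delta delta_e => <-.
Qed.

End CyclicIdempotents.

(** Expanding delta along b = e b fixes the part of delta(b) outside e A, and
along b = b f the part outside A f'.  For vertices on cycles, the product
e * b' vanishes unless e = e', and b * f' unless f = f'; in these cases the
cycle has length 1 < n and the scalar a, respectively c, is 0.  This is why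
both products appear scaled in the hypotheses. *)
Lemma delta_arrow (e e' f f' b b' b'' : A) (a c mu l : K) :
  e * b = b -> b * f = b -> sigma b = mu *: b' -> sigma f = f' ->
  e' * b' = b' ->
  delta e = a *: (e - zeta *: e') -> delta f = c *: (f - zeta *: f') ->
  a *: (e * b') = 0 -> c *: (b * f') = 0 ->
  e * delta b * f' = l *: b'' ->
  delta b = c *: b - (a * zeta * mu) *: b' + l *: b''.
Proof.
move=> eb bf sb sf eb' de df eb0 bf0 L.
have R : delta b = c *: b + delta b * f'.
  rewrite -{1}bf deltaM sf df -sc_scaleAr mulrBr bf -sc_scaleAr scalerBr.
  by rewrite !scalerA mulrC -scalerA bf0 scaler0 subr0.
have Lf : delta b = e * delta b - (a * zeta * mu) *: b'.
  rewrite -{1}eb deltaM sb de; congr (_ + _).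
  rewrite -sc_scaleAl -sc_scaleAr mulrBl -sc_scaleAl eb'.
  rewrite scalerA mulrC -[(mu * a) *: _]scalerA.
  rewrite scalerBr eb0 sub0r scalerN !scalerA; congr (- (_ *: _)); ring.
rewrite {1}Lf {1}R mulrDr -sc_scaleAr eb mulrA L.
by rewrite -!addrA [l *: _ + _]addrC.
Qed.

(** The combinatorics of the arrows from a cycle of length m to a cycle of length
m'.  Indexing by all pairs (i, j) is compatible with missing arrows: b i j is
then 0. *)
Section ArrowGrid.
Variables (n m m' : nat).
Hypothesis prim : n.-primitive_root zeta.
Hypotheses (n_gt1 : (1 < n)%N) (hmn : (m %| n)%N) (hm'n : (m' %| n)%N).
Variables (gp gm : K) (mu lambda : 'I_m -> 'I_m' -> K).
Hypotheses (gp0 : (m < n)%N -> gp = 0) (gm0 : (m' < n)%N -> gm = 0).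
Variables (ep : 'I_m -> A) (em : 'I_m' -> A) (b : 'I_m -> 'I_m' -> A).
Hypothesis ep_b : forall i k j, ep i * b k j = if i == k then b k j else 0.
Hypothesis b_em : forall i k j, b i k * em j = if j == k then b i k else 0.
Hypothesis sigma_em : forall j, sigma (em j) = em (ordS j).
Hypothesis sigma_b : forall i j, sigma (b i j) = mu i j *: b (ordS i) (ordS j).
Hypothesis delta_ep : forall i,
  delta (ep i) = (gp * zeta ^+ i) *: (ep i - zeta *: ep (ordS i)).
Hypothesis delta_em : forall j,
  delta (em j) = (gm * zeta ^+ j) *: (em j - zeta *: em (ordS j)).
Hypothesis lambdaE : forall i j,
  ep i * delta (b i j) * em (ordS j) = lambda i j *: b i (ordS j).

Lemma delta_grid i j : delta (b i j) = (gm * zeta ^+ j) *: b i j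
  - (gp * mu i j * zeta ^+ i.+1) *: b (ordS i) (ordS j)
  + lambda i j *: b i (ordS j).
Proof.
have -> : gp * mu i j * zeta ^+ i.+1 = gp * zeta ^+ i * zeta * mu i j.
  by rewrite exprS; ring.
apply: (delta_arrow _ _ (sigma_b i j) (sigma_em j) _ (delta_ep i) (delta_em j)
          _ _ (lambdaE i j)).
- by rewrite ep_b eqxx.
- by rewrite b_em eqxx.
- by rewrite ep_b eqxx.
- rewrite ep_b; case: eqP => [Si|_]; last by rewrite scaler0.
  by rewrite gp0 ?mul0r ?scale0r // (ordS_fixed (esym Si)).
- rewrite b_em; case: eqP => [Sj|_]; last by rewrite scaler0.
  by rewrite gm0 ?mul0r ?scale0r // (ordS_fixed Sj).
Qed.

(** Comparing the two sides of delta sigma = zeta sigma delta on b i j, the terms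
in gm and gp cancel identically, which leaves the terms in lambda. *)
Lemma lambda_sigma i j :
  (lambda (ordS i) (ordS j) * mu i j) *: b (ordS i) (ordS (ordS j)) =
  (zeta * lambda i j * mu i (ordS j)) *: b (ordS i) (ordS (ordS j)).
Proof.
have gmS : gm * zeta ^+ ordS j = gm * zeta ^+ j.+1.
  by rewrite (scal_root_mod prim hm'n gm0).
have gpS : gp * zeta ^+ ordS i = gp * zeta ^+ i.+1.
  by rewrite (scal_root_mod prim hmn gp0).
have sZ a p : sigma (a *: p) = a *: sigma p by exact: linearZ.
have dZ a p : delta (a *: p) = a *: delta p by exact: linearZ.
have := delta_sigma (b i j).
rewrite sigma_b dZ !delta_grid [sigma (_ + _)]linearD [sigma (_ - _)]linearB.
rewrite !sZ !sigma_b !scalerDr !scalerN !scalerA gmS.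
have -> : mu i j * (gm * zeta ^+ j.+1) = zeta * (gm * zeta ^+ j) * mu i j.
  by rewrite exprS; ring.
have -> : mu i j * (gp * mu (ordS i) (ordS j) * zeta ^+ (ordS i).+1) =
          zeta * (gp * mu i j * zeta ^+ i.+1) * mu (ordS i) (ordS j).
  transitivity (mu i j * mu (ordS i) (ordS j) * zeta * (gp * zeta ^+ ordS i)).
    by rewrite exprS; ring.
  by rewrite gpS; ring.
by move/addrI; rewrite [mu i j * _]mulrC.
Qed.

End ArrowGrid.

End SkewDerivation.

(** * The n-th power of the action of x on arrows *)

Section NilpotentArrows.
Variables (K : fieldType) (n : nat) (zeta : K).
Hypothesis prim : n.-primitive_root zeta.
Variables (m m' : nat) (gp gm : K) (mu lambda : 'I_m -> 'I_m' -> K).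
Hypotheses (hmn : (m %| n)%N) (hm'n : (m' %| n)%N).
Hypotheses (gp0 : (m < n)%N -> gp = 0) (gm0 : (m' < n)%N -> gm = 0).
Hypothesis lambda_mu : forall i j,
  lambda (ordS i) (ordS j) * mu i j = zeta * lambda i j * mu i (ordS j).

(* The operators live on the free vector space on all pairs (i, j), where each
   of them is determined by its values on the basis; the span of the arrows is
   a quotient of it, on which basis vectors may become 0. *)
Let I : choiceType := ('I_m * 'I_m')%type.
Let W := {malg K[I]}.

Let diagS (t : I) : I := (ordS t.1, ordS t.2).
Let colS (t : I) : I := (t.1, ordS t.2).

Section Operators.
Variables D L G : {linear W -> W}.
Hypothesis DU : forall t, D << t >> = (gm * zeta ^+ t.2) *: << t >>.
Hypothesis LU : forall t, L << t >> = lambda t.1 t.2 *: << colS t >>.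
Hypothesis GU : forall t,
  G << t >> = (- (gp * zeta ^+ t.1.+1) * mu t.1 t.2) *: << diagS t >>.

Let basis_qcomm (f h : {linear W -> W}) :
  (forall t, f (h << t >>) = zeta *: h (f << t >>)) ->
  forall v, f (h v) = zeta *: h (f v).
Proof.
move=> fh; elim/malg_lind => [|a u v IHu IHv|//]; first by rewrite !linear0.
by rewrite !linearP IHu IHv.
Qed.

Let gmS (j : 'I_m') : gm * zeta ^+ ordS j = zeta * (gm * zeta ^+ j).
Proof. by rewrite (scal_root_mod prim hm'n gm0) exprS mulrCA. Qed.

Let DL v : D (L v) = zeta *: L (D v).
Proof.
apply: basis_qcomm => t.
rewrite LU DU [D _]linearZ [L _]linearZ /= DU LU !scalerA.
rewrite gmS; congr (_ *: _); ring.
Qed.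

Let DG v : D (G v) = zeta *: G (D v).
Proof.
apply: basis_qcomm => t.
rewrite GU DU [D _]linearZ [G _]linearZ /= DU GU !scalerA.
rewrite gmS; congr (_ *: _); ring.
Qed.

Let LG v : L (G v) = zeta *: G (L v).
Proof.
apply: basis_qcomm => t.
rewrite GU LU [L _]linearZ [G _]linearZ /= GU LU !scalerA.
congr (_ *: _) => /=; rewrite mulrAC -[LHS]mulrA lambda_mu; ring.
Qed.

(** D + L q-commutes with G, and D with L, so the q-binomial theorem applies
twice. *)
Lemma iter_sum_operators i j :
  \prod_(l < n) mu (iter l (@ordS m) i) (iter l (@ordS m') j) = 1 ->
  iter n (fun v => (D v + L v) + G v) << (i, j) >> =
  (gm ^+ n + \prod_(l < n) lambda i (iter l (@ordS m') j) - gp ^+ n)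
    *: << (i, j) >>.
Proof.
move=> mu1; pose DL' : {linear W -> W} := (D \+ L)%R.
have DLG v : DL' (G v) = zeta *: G (DL' v).
  by rewrite [G (_ + _)]linearD scalerDr -DG -LG.
rewrite (qbinomial_root DLG _ prim) (qbinomial_root DL _ prim).
have iS k : iter k colS (i, j) = (i, iter k (@ordS m') j).
  by elim: k => //= k ->.
have dS k : iter k diagS (i, j) = (iter k (@ordS m) i, iter k (@ordS m') j).
  by elim: k => //= k ->.
have isame k (t : I) : iter k id t = t by elim: k.
rewrite (iter_monomial (s := id) DU) (iter_monomial LU) (iter_monomial GU).
rewrite iS dS (iter_ordS_id i hmn) (iter_ordS_id j hm'n) isame -!scalerDl.
apply: (congr1 (fun a => a *: << (i, j) >>)).
congr (_ + _ + _).
- under eq_bigr do rewrite isame.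
  rewrite prodr_const card_ord exprMn exprAC (prim_expr_order prim).
  by rewrite expr1n mulr1.
- by apply: eq_bigr => l _; rewrite iS.
under eq_bigr do rewrite dS /=.
by rewrite big_split /= mu1 mulr1 (prod_scal_root prim hmn gp0).
Qed.

End Operators.

(** The identity for the n-th powers descends along the linear map from the free
space that sends the pair (i, j) to b i j and intertwines D + L + G with X. *)
Lemma iter_arrow_action (V : lmodType K) (X : {linear V -> V})
    (b : 'I_m -> 'I_m' -> V) i j :
  (forall i j, X (b i j) = (gm * zeta ^+ j) *: b i j
     - (gp * mu i j * zeta ^+ i.+1) *: b (ordS i) (ordS j)
     + lambda i j *: b i (ordS j)) ->
  \prod_(l < n) mu (iter l (@ordS m) i) (iter l (@ordS m') j) = 1 ->
  iter n X (b i j) =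
    (gm ^+ n + \prod_(l < n) lambda i (iter l (@ordS m') j) - gp ^+ n) *: b i j.
Proof.
move=> Xb mu1.
pose monomial (c : I -> K) (s : I -> I) : {linear W -> W} :=
  lext (fun t => c t *: << s t >> : W).
have monoU c s t : monomial c s << t >> = c t *: << s t >> by exact: lextU.
move: monomial monoU => monomial monoU.
pose Phi : {linear W -> V} := lext (fun t : I => b t.1 t.2).
have PhiU t : Phi << t >> = b t.1 t.2 by exact: lextU.
move: Phi PhiU => Phi PhiU.
have DU := monoU (fun t => gm * zeta ^+ t.2) id.
have LU := monoU (fun t => lambda t.1 t.2) colS.
have GU := monoU (fun t => - (gp * zeta ^+ t.1.+1) * mu t.1 t.2) diagS.
move: (monomial _ _) DU (monomial _ _) LU (monomial _ _) GU => D DU L LU G GU.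
have PhiZ a w : Phi (a *: w) = a *: Phi w by exact: linearZ.
have PhiX w : Phi (D w + L w + G w) = X (Phi w).
  elim/malg_lind: w => [|a u v IHu IHv|t].
  - by rewrite !(linear0, addr0).
  - rewrite [Phi (a *: u + v)]linearP [X _]linearP -IHu -IHv -[RHS]linearP.
    congr (Phi _); rewrite [D _]linearP [L _]linearP [G _]linearP !scalerDr.
    rewrite [RHS]addrACA; congr (_ + _).
    by rewrite addrACA.
  rewrite DU LU GU [Phi (_ + _)]linearD [Phi (_ + _)]linearD !PhiZ !PhiU Xb /=.
  rewrite addrAC; congr (_ + _ + _).
  by rewrite -scaleNr /=; congr (_ *: _); ring.
have PhiXn w : iter n X (Phi w) = Phi (iter n (fun u => D u + L u + G u) w).
  by elim: n => //= k ->; rewrite PhiX.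
have {1}-> : b i j = Phi << (i, j) >> by rewrite PhiU.
by rewrite PhiXn (iter_sum_operators DU LU GU mu1) linearZ /= PhiU.
Qed.

End NilpotentArrows.

(** * Path algebras of subquivers of K_{m,m'} *)

Lemma malg_sum (K : fieldType) (B : choiceType) (u : {malg K[B]}) :
  u = \sum_(p <- msupp u) u@_p *: << p >>.
Proof.
rewrite {1}(monalgE u); apply: eq_bigr => p _.
by apply/malgP => k; rewrite mcoeffZ !mcoeffU mulrnAr mulr1.
Qed.

Section PathAlgebra.
Variables (K : fieldType) (m m' : nat) (Q : subquiver (Kquiver m m')).
Let A := path_alg (quiver_of Q) K.
Implicit Types (v w : vert (Kquiver m m')) (a : arrow (Kquiver m m')).

Lemma pe_in v (hv : v \in svert Q) :
  pe K Q v = sc_elt (S := A) (ptriv (Q := quiver_of Q) (exist _ v hv)).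
Proof. by rewrite /pe insubT. Qed.

Lemma pb_in a (ha : a \in sarrow Q) :
  pb K Q a = sc_elt (S := A) (parrow (Q := quiver_of Q) (exist _ a ha)).
Proof. by rewrite /pb insubT. Qed.

Lemma pe_out v : v \notin svert Q -> pe K Q v = 0.
Proof. by move=> h; rewrite /pe insubF //; apply/negbTE. Qed.

Lemma pb_out a : a \notin sarrow Q -> pb K Q a = 0.
Proof. by move=> h; rewrite /pb insubF //; apply/negbTE. Qed.

Lemma pb_neq0 a : a \in sarrow Q -> pb K Q a != 0.
Proof.
move=> ha; rewrite pb_in; set p := parrow _.
apply/eqP => /malgP /(_ p).
by rewrite mcoeffU eqxx mcoeff0 => /eqP; rewrite oner_eq0.
Qed.

Lemma pe_elt v (p : qpath (quiver_of Q)) :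
  pe K Q v * sc_elt (S := A) p =
  if v == val (pstart p) then sc_elt (S := A) p else 0.
Proof.
case: (boolP (v \in svert Q)) => hv; last first.
  rewrite pe_out // mul0r; case: eqP => // E.
  by rewrite E (valP (pstart p)) in hv.
rewrite pe_in sc_eltM; set t := ptriv _.
have [E|nE] := eqVneq v (val (pstart p)); last first.
  by apply: path_mul_0; apply: contraNneq nE => <-.
have Et : pend t = pstart p by apply: val_inj.
rewrite [LHS](path_mul_cat _ Et); congr << _ >>; apply: val_inj.
by rewrite (val_pcat Et) [RHS]surjective_pairing -[(val p).1]/(pstart p) -Et.
Qed.

Lemma elt_pe v (p : qpath (quiver_of Q)) :
  sc_elt (S := A) p * pe K Q v =
  if v == val (pend p) then sc_elt (S := A) p else 0.
Proof.
case: (boolP (v \in svert Q)) => hv; last first.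
  rewrite pe_out // mulr0; case: eqP => // E.
  by rewrite E (valP (pend p)) in hv.
rewrite pe_in sc_eltM; set t := ptriv _.
have [E|nE] := eqVneq v (val (pend p)); last first.
  by apply: path_mul_0; apply: contraNneq nE => ->.
have Et : pend p = pstart t by apply: val_inj.
rewrite [LHS](path_mul_cat _ Et); congr << _ >>; apply: val_inj.
by rewrite (val_pcat Et) /= cats0 [RHS]surjective_pairing.
Qed.

Lemma pe_mul v w : pe K Q v * pe K Q w = if v == w then pe K Q v else 0.
Proof.
case: (boolP (w \in svert Q)) => hw.
  by rewrite [pe K Q w]pe_in pe_elt /=; case: eqP => // ->; rewrite pe_in.
by rewrite (pe_out hw) mulr0; case: eqP => // ->; rewrite pe_out.
Qed.

Lemma pe_pb v a : pe K Q v * pb K Q a = if v == src a then pb K Q a else 0.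
Proof.
case: (boolP (a \in sarrow Q)) => ha; first by rewrite pb_in pe_elt.
by rewrite pb_out // mulr0 if_same.
Qed.

Lemma pb_pe v a : pb K Q a * pe K Q v = if v == tgt a then pb K Q a else 0.
Proof.
case: (boolP (a \in sarrow Q)) => ha; first by rewrite pb_in elt_pe.
by rewrite pb_out // mul0r if_same.
Qed.

Lemma pe_filt v : path_filt 0 (pe K Q v).
Proof.
move=> p; case: (boolP (v \in svert Q)) => hv.
  by rewrite pe_in msuppU oner_eq0 in_fset1 => /eqP ->.
by rewrite pe_out // msupp0 in_fset0.
Qed.

(** An element of filtration degree 0 is a combination of trivial paths, which
are orthogonal idempotents. *)
Lemma filt0_diagonal (u : A) : path_filt 0 u ->
  exists c : vert (Kquiver m m') -> K, forall v,
    pe K Q v * u = c v *: pe K Q v /\ u * pe K Q v = c v *: pe K Q v.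
Proof.
move=> fu.
have -> : u = \sum_(p <- msupp (u : {malg K[_]})) u@_p *: sc_elt (S := A) p.
  exact: malg_sum.
rewrite big_seq; elim/big_ind: _ => [|y z [c hc] [d hd]|p /fu].
- by exists (fun=> 0) => v; rewrite mulr0 mul0r scale0r.
- exists (fun v => c v + d v) => v; have [c1 c2] := hc v; have [d1 d2] := hd v.
  rewrite scalerDl.
  by split; [rewrite mulrDr c1 d1|rewrite mulrDl c2 d2].
rewrite leqn0 size_eq0 => /eqP tr.
have {tr}-> : p = ptriv (pstart p).
  by apply: val_inj; rewrite /= -tr [LHS]surjective_pairing.
move: (pstart p) (u@_ _) => w a; exists (fun v => a * (v == val w)%:R) => v.
rewrite -sc_scaleAr -sc_scaleAl pe_elt elt_pe /pend /=.
case: eqP => [->|_]; last by rewrite !(scaler0, mulr0, scale0r).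
by rewrite mulr1; split; congr (_ *: _); rewrite /pe valK.
Qed.

(** Every vertex i+ is a source and every j- a sink, so a path from i+ to j- has
exactly one arrow. *)
Lemma corner_arrow i j (u : A) : exists c : K,
  ep K Q i * u * em K Q j = c *: b_ K Q i j.
Proof.
elim/malg_lind: u => [|a y z [c hc] [d hd]|p].
- by exists 0; rewrite mulr0 mul0r scale0r.
- exists (a * c + d); rewrite mulrDr mulrDl -sc_scaleAr -sc_scaleAl hc hd.
  by rewrite scalerDl scalerA.
rewrite [ep K Q i * _](pe_elt (vplus m' i) p).
case: eqP => [Es|_]; last by exists 0; rewrite mul0r scale0r.
rewrite [_ * em K Q j](elt_pe (vminus m j) p).
case: eqP => [Et|_]; last by exists 0; rewrite scale0r.
exists 1; rewrite scale1r; case: p Es Et => [[v [|a [|a' s]]]] //= hp.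
- (* A trivial path does not join a source to a sink. *)
  by move=> Ev; rewrite /pend /= -Ev.
- rewrite /pstart /pend /= => Es Et.
  case/andP: (hp) => /eqP Ev _; rewrite -Ev /= in Es.
  case: a hp Ev Es Et => [[i' j'] ha] hp Ev [Ei] [Ej].
  subst i' j'; rewrite /b_ (pb_in ha); congr << _ >>; apply: val_inj => /=.
  by rewrite -Ev.
- (* No arrow starts where another one ends. *)
  by case/andP: (hp).
Qed.

End PathAlgebra.

Lemma Zn_stable_inv n m m' (Q : subquiver (Kquiver m m')) v :
  (m %| n)%N -> (m' %| n)%N -> (0 < n)%N -> Zn_stable Q ->
  g_vert v \in svert Q -> v \in svert Q.
Proof.
move=> hmn hm'n n0 [stV _]; apply: (stable_preimset stV n0).
have it k : iter k (@g_vert m m') v = match v with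
    | inl i => inl (iter k (@ordS m) i)
    | inr j => inr (iter k (@ordS m') j)
    end by elim: k => [|k /= ->]; case: (v).
by rewrite it; case: (v) => i; rewrite iter_ordS_id.
Qed.

(** * The skew derivation attached to an action of the Taft algebra *)

Section TaftAction.
Variables (K : fieldType) (n : nat) (zeta : K).
Hypotheses (n_gt1 : (1 < n)%N) (prim : n.-primitive_root zeta).
Variables (A : scalg K) (act : taft prim -> A -> A).
Hypothesis actA :
  module_algebra (@taft_Delta K n zeta prim) (@taft_eps K n zeta prim) act.

Let act_linear h : linear (act h). Proof. by case: actA => -[]. Qed.

HB.instance Definition _ h :=
  GRing.isLinear.Build K A A _ (act h) (act_linear h).

Definition act_map h : {linear A -> A} := act h.

Let act_bilinear p : linear (act^~ p). Proof. by case: actA => -[]. Qed.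

Let act0 p : act 0 p = 0.
Proof.
have := act_bilinear p 1 0 0; rewrite !scale1r addr0 => /eqP.
by rewrite -subr_eq subrr eq_sym => /eqP.
Qed.

Lemma act_exp h k p : act (h ^+ k) p = iter k (act h) p.
Proof.
case: actA => -[_ _ act1 actM] _.
by elim: k => [|k IH]; rewrite ?expr0 // exprS actM IH.
Qed.

Lemma iter_act_g p : iter n (act_map (taft_g prim)) p = p.
Proof. by rewrite -[LHS]act_exp taft_gn; case: actA => -[]. Qed.

Lemma iter_act_x p : iter n (act_map (taft_x prim)) p = 0.
Proof. by rewrite -[LHS]act_exp taft_xn act0. Qed.

Lemma act_xg p : act_map (taft_x prim) (act_map (taft_g prim) p) =
  zeta *: act_map (taft_g prim) (act_map (taft_x prim) p).
Proof.
case: (actA) => -[_ _ act1 actM] _; rewrite /act_map /= -!actM taft_xg.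
have := act_bilinear p zeta (taft_g prim * taft_x prim) 0.
by rewrite act0 !addr0.
Qed.

Let n_gt0 : (0 < n)%N := ltnW n_gt1.

Let act_tmon a b c d p q : (b < n)%N -> (d < n)%N ->
  lext (fun s => act (sc_elt s.1) p * act (sc_elt s.2) q)
    (tensor (tmon K n a b : taft prim) (tmon K n c d : taft prim)) =
  act (tmon K n a b) p * act (tmon K n c d) q.
Proof.
by move=> hb hd; rewrite /tensor !(tmonE prim) // ptensU lextU.
Qed.

Lemma act_g_mul p q : act_map (taft_g prim) (p * q) =
  act_map (taft_g prim) p * act_map (taft_g prim) q.
Proof.
case: actA => _ [actM _]; rewrite /act_map /= actM taft_Delta_g //.
exact: act_tmon.
Qed.

Lemma act_x_mul p q : act_map (taft_x prim) (p * q) =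
  p * act_map (taft_x prim) q +
  act_map (taft_x prim) p * act_map (taft_g prim) q.
Proof.
case: (actA) => -[_ _ act1 _] [actM _].
rewrite /act_map /= actM taft_Delta_x // linearD; congr (_ + _); last exact: act_tmon.
by rewrite -[X in _ = X * _](act1 p); apply: act_tmon.
Qed.

(** Since the actions of g and x determine the whole action, this pair of maps
with its relations is an equivalent, coalgebra-free form of the action. *)
Lemma taft_skew_derivation : exists sigma delta : {linear A -> A},
  [/\ forall p, act (taft_g prim) p = sigma p
    & forall p, act (taft_x prim) p = delta p] /\
  [/\ forall p q, sigma (p * q) = sigma p * sigma q,
      forall p q, delta (p * q) = p * delta q + delta p * sigma q,
      forall p, delta (sigma p) = zeta *: sigma (delta p),
      forall p, iter n sigma p = p
    & forall p, iter n delta p = 0].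
Proof.
exists (act_map (taft_g prim)), (act_map (taft_x prim)); split=> //.
split; [exact: act_g_mul|exact: act_x_mul|exact: act_xg|exact: iter_act_g|].
exact: iter_act_x.
Qed.

End TaftAction.

(** * The classification of the actions *)

Theorem theorem6p3 (K : fieldType) (n : nat) (zeta : K)
    (hn : (2 <= n)%N) (prim : n.-primitive_root zeta)
    (m m' : nat) (hm : (1 <= m)%N) (hm' : (1 <= m')%N)
    (hmn : (m %| n)%N) (hm'n : (m' %| n)%N)
    (Q : subquiver (Kquiver m m')) (hQ : Zn_stable Q)
    (act : taft prim -> path_alg (quiver_of Q) K -> path_alg (quiver_of Q) K)
    (hact : taft_action act) (hext : extends_Zn_action act) :
  let x := taft_x prim in
  let g := taft_g prim in
  let e_p := ep K Q in
  let e_m := em K Q in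
  let b := b_ K Q in
  exists (gp gm : K) (mu lambda : 'I_m -> 'I_m' -> K),
    [/\ ((m < n)%N -> gp = 0),
        ((m' < n)%N -> gm = 0),
        (forall i, vplus m' i \in svert Q ->
           act x (e_p i) = (gp * zeta ^+ i) *: (e_p i - zeta *: e_p (ordS i)))
      & (forall j, vminus m j \in svert Q ->
           act x (e_m j) = (gm * zeta ^+ j) *: (e_m j - zeta *: e_m (ordS j)))] /\
    forall (i : 'I_m) (j : 'I_m'), barr i j \in sarrow Q ->
      [/\ mu i j != 0,
          act g (b i j) = mu i j *: b (ordS i) (ordS j)
        & act x (b i j) = (gm * zeta ^+ j) *: b i j
                        - (gp * mu i j * zeta ^+ i.+1) *: b (ordS i) (ordS j)
                        + lambda i j *: b i (ordS j)] /\
      [/\ \prod_(l < n) mu (iter l (@ordS m) i) (iter l (@ordS m') j) = 1,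
          (barr i (ordS j) \notin sarrow Q -> lambda i j = 0),
          lambda (ordS i) (ordS j) * mu i j = zeta * lambda i j * mu i (ordS j)
        & gp ^+ n = gm ^+ n + \prod_(l < n) lambda i (iter l (@ordS m') j)].
Proof.
move=> x g e_p e_m b.
have n0 : (0 < n)%N := ltnW hn.
case: hact => actA filt; case: hext => gP gM gB.
have [sigma [delta [[actg actx] [sM dM ds sn dn]]]] :=
  taft_skew_derivation hn actA.
have iter_arrow i j k : iter k (@g_arrow m m') (i, j) =
    (iter k (@ordS m) i, iter k (@ordS m') j).
  by elim: k => //= k ->.
have ep_b i k j : e_p i * b k j = if i == k then b k j else 0.
  exact: pe_pb.
have b_em i k j : b i k * e_m j = if j == k then b i k else 0.
  exact: pb_pe.
have ep_ep i k : e_p i * e_p k = if i == k then e_p i else 0.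
  exact: pe_mul.
have em_em i k : e_m i * e_m k = if i == k then e_m i else 0.
  exact: pe_mul.
have b_out i j : barr i j \notin sarrow Q -> b i j = 0 by exact: pb_out.
have b_neq0 i j : barr i j \in sarrow Q -> b i j != 0 by exact: pb_neq0.
have corner i j u : exists c : K, e_p i * u * e_m j = c *: b i j.
  exact: corner_arrow.
have outS i j : barr i j \notin sarrow Q ->
    barr (ordS i) (ordS j) \notin sarrow Q.
  apply: contra; apply: (stable_preimset (t := barr i j) (proj2 hQ) n0).
  by rewrite iter_arrow !iter_ordS_id.
have se_p i : sigma (e_p i) = e_p (ordS i).
  case: (boolP (vplus m' i \in svert Q)) => [/gP|out]; first by rewrite -actg.
  rewrite /e_p /ep !pe_out ?linear0 //; apply: contra out.
  exact: (Zn_stable_inv (v := vplus m' i) hmn hm'n n0 hQ).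
have se_m j : sigma (e_m j) = e_m (ordS j).
  case: (boolP (vminus m j \in svert Q)) => [/gM|out]; first by rewrite -actg.
  rewrite /e_m /em !pe_out ?linear0 //; apply: contra out.
  exact: (Zn_stable_inv (v := vminus m j) hmn hm'n n0 hQ).
have diag v : exists c : vert (Kquiver m m') -> K, forall w,
    pe K Q w * delta (pe K Q v) = c w *: pe K Q w /\
    delta (pe K Q v) * pe K Q w = c w *: pe K Q w.
  by apply: filt0_diagonal; rewrite -actx; apply: filt; apply: pe_filt.
have [C hC] := fin_all_exists diag.
have [gp [gp0 dp]] : exists c : K, ((m < n)%N -> c = 0) /\
    forall i, delta (e_p i) = (c * zeta ^+ i) *: (e_p i - zeta *: e_p (ordS i)).
  apply: (delta_cyclic_idempotents sM dM ds hn prim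
    (C := fun i k => C (vplus m' i) (vplus m' k)) hm ep_ep se_p) => i k.
    by case: (hC (vplus m' i) (vplus m' k)).
  by case: (hC (vplus m' i) (vplus m' k)).
have [gm [gm0 dm]] : exists c : K, ((m' < n)%N -> c = 0) /\
    forall j, delta (e_m j) = (c * zeta ^+ j) *: (e_m j - zeta *: e_m (ordS j)).
  apply: (delta_cyclic_idempotents sM dM ds hn prim
    (C := fun i k => C (vminus m i) (vminus m k)) hm' em_em se_m) => i k.
    by case: (hC (vminus m i) (vminus m k)).
  by case: (hC (vminus m i) (vminus m k)).
(* For a missing arrow both sides are 0; the value 1 keeps mu nonzero. *)
have exmu i j : exists c : K,
    c != 0 /\ sigma (b i j) = c *: b (ordS i) (ordS j).
  case: (boolP (barr i j \in sarrow Q)) => [/gB [c c0 hc]|out].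
    by exists c; rewrite -actg.
  exists 1; rewrite oner_neq0; split=> //.
  by rewrite (b_out _ _ out) (b_out _ _ (outS _ _ out)) linear0 scaler0.
have [mu hmu] := fin_all_exists (fun i => fin_all_exists (exmu i)).
have exlam i j : exists c : K,
    e_p i * delta (b i j) * e_m (ordS j) = c *: b i (ordS j) /\
    (barr i (ordS j) \notin sarrow Q -> c = 0).
  have [c hc] := corner i (ordS j) (delta (b i j)).
  case: (boolP (barr i (ordS j) \in sarrow Q)) => [_|out]; first by exists c.
  by exists 0; rewrite hc (b_out _ _ out) !scaler0.
have [lam hlam] := fin_all_exists (fun i => fin_all_exists (exlam i)).
have sb i j := proj2 (hmu i j).
have lamE i j := proj1 (hlam i j).
have lam0 i j := proj2 (hlam i j).
clearbody e_p e_m b.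
have db := delta_grid dM hn gp0 gm0 ep_b b_em se_m sb dp dm lamE.
have lam_mu i j :
    lam (ordS i) (ordS j) * mu i j = zeta * lam i j * mu i (ordS j).
  case: (boolP (barr i (ordS j) \in sarrow Q)) => [inQ|out]; last first.
    by rewrite (lam0 _ _ out) (lam0 _ _ (outS _ _ out)) mulr0 !mul0r.
  have := lambda_sigma dM ds prim hn hmn hm'n gp0 gm0 ep_b b_em se_m sb
            dp dm lamE i j.
  move/eqP; rewrite -subr_eq0 -scalerBl scaler_eq0 subr_eq0.
  by rewrite (negPf (b_neq0 _ _ (proj2 hQ _ inQ))) orbF => /eqP.
exists gp, gm, mu, lam; split; first by split=> // i _; rewrite actx.
move=> i j inQ; split; first by rewrite actg actx; have [] := hmu i j.
have bI c d : c *: b i j = d *: b i j -> c = d.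
  move/eqP; rewrite -subr_eq0 -scalerBl scaler_eq0 subr_eq0.
  by rewrite (negPf (b_neq0 _ _ inQ)) orbF => /eqP.
have mu1 : \prod_(l < n) mu (iter l (@ordS m) i) (iter l (@ordS m') j) = 1.
  apply: bI; rewrite scale1r -[RHS]sn.
  have sbn k : iter k sigma (b i j) =
      (\prod_(l < k) mu (iter l (@ordS m) i) (iter l (@ordS m') j)) *:
      b (iter k (@ordS m) i) (iter k (@ordS m') j).
    have := iter_monomial (v := fun t : 'I_m * 'I_m' => b t.1 t.2)
      (c := fun t => mu t.1 t.2) (s := @g_arrow m m')
      (fun t => sb t.1 t.2) k (i, j).
    move=> /= ->; rewrite iter_arrow /=; apply: (congr1 (fun a => a *: _)).
    by apply: eq_bigr => l _; rewrite iter_arrow.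
  by rewrite sbn !iter_ordS_id.
split=> //; first exact: lam0.
have := iter_arrow_action prim hmn hm'n gp0 gm0 lam_mu db mu1.
rewrite dn -(scale0r (b i j)) => /bI /esym /eqP.
by rewrite subr_eq0 eq_sym => /eqP.
Qed.
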